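(* The ideal $\mathfrak{a}_n=\mathfrak{p}_1+\cdots+\mathfrak{p}_n$ is the only nonzero prime ideal $\mathfrak{p}$ of $\mathbb{S}_n$ such that $\sigma(\mathfrak{p})=\mathfrak{p}$ for all $\sigma\in G_n$.
   Context: $K$ is a field of characteristic zero. $\mathbb{S}_n$ is the $K$-algebra generated by $x_1,\dots,x_n,y_1,\dots,y_n$ with defining relations $y_ix_i=1$ and $[x_i,y_j]=[x_i,x_j]=[y_i,y_j]=0$ for $i\ne j$; $G_n=\mathrm{Aut}_{K\text{-alg}}(\mathbb{S}_n)$. For $k,l\in\mathbb{N}$, $E_{kl}(i):=x_i^ky_i^l-x_i^{k+1}y_i^{l+1}$, $F(i):=\bigoplus_{k,l}KE_{kl}(i)$, and $\mathfrak{p}_i:=F(i)\otimes\bigotimes_{j\ne i}\mathbb{S}_1(j)\subset\mathbb{S}_n=\bigotimes_j\mathbb{S}_1(j)$ (the ideal generated by $1-x_iy_i$). *)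

(* Defs.v *)
From HB Require Import structures.
From mathcomp Require Import all_boot all_order all_algebra.
Set Implicit Arguments. Unset Strict Implicit. Unset Printing Implicit Defensive.
Import Order.TTheory GRing.Theory Num.Theory.
Local Open Scope ring_scope.

Definition Sn_rel (K : fieldType) (B : algType K) (n : nat) (u v : 'I_n -> B) : Prop :=
  (forall i, v i * u i = 1) /\
  (forall i j, i != j ->
     [/\ u i * v j = v j * u i, u i * u j = u j * u i & v i * v j = v j * v i]).

(* (A, x, y) is the K-algebra generated by x_1..x_n, y_1..y_n with defining
   relations Sn_rel, i.e. it satisfies the universal property of the
   presentation. *)
Definition is_Sn (K : fieldType) (A : algType K) (n : nat) (x y : 'I_n -> A) : Prop :=
  Sn_rel x y /\
  forall (B : algType K) (u v : 'I_n -> B), Sn_rel u v ->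
    exists f : {lrmorphism A -> B},
      (forall i, f (x i) = u i /\ f (y i) = v i) /\
      forall g : {lrmorphism A -> B},
        (forall i, g (x i) = u i /\ g (y i) = v i) -> forall a, g a = f a.

Definition is_ideal (R : pzRingType) (I : R -> Prop) : Prop :=
  [/\ I 0, (forall a b, I a -> I b -> I (a + b)) &
      forall r a, I a -> I (r * a) /\ I (a * r)].

(* Prime ideal of a (noncommutative) ring: proper, and IJ ⊆ P implies I ⊆ P
   or J ⊆ P for all ideals I, J (IJ ⊆ P iff all products a*b lie in P). *)
Definition is_prime_ideal (R : pzRingType) (P : R -> Prop) : Prop :=
  [/\ is_ideal P, ~ P 1 &
      forall I J : R -> Prop, is_ideal I -> is_ideal J ->
        (forall a b, I a -> J b -> P (a * b)) ->
        (forall a, I a -> P a) \/ (forall b, J b -> P b)].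

Definition ideal_gen (R : pzRingType) (S : R -> Prop) : R -> Prop :=
  fun a => forall I : R -> Prop, is_ideal I -> (forall s, S s -> I s) -> I a.

Definition p_ideal (K : fieldType) (A : algType K) (n : nat) (x y : 'I_n -> A)
  (i : 'I_n) : A -> Prop :=
  ideal_gen (fun s => s = 1 - x i * y i).

Definition a_ideal (K : fieldType) (A : algType K) (n : nat) (x y : 'I_n -> A) : A -> Prop :=
  fun a => exists f : 'I_n -> A,
    (forall i, p_ideal x y i (f i)) /\ a = \sum_(i < n) f i.

Definition is_alg_aut (K : fieldType) (A : algType K) (s : {lrmorphism A -> A}) : Prop :=
  bijective s.

Definition image_eq (A : Type) (s : A -> A) (P : A -> Prop) : Prop :=
  forall b, P b <-> exists a, P a /\ s a = b.

(* Main.v *)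
(* [p_1 ... p_n] is contained in every nonzero ideal: if [a = sum c_(k,m) x^k y^m] is
   nonzero and [m] is minimal with some [c_(k,m) <> 0], then sandwiching [a] between
   [E y^k] and [x^m E], where [E = prod_i (1 - x_i y_i)], gives [c_(k,m) E].  Hence a
   nonzero prime contains some [1 - x_i y_i], and all of them if it is stable under
   the permutations of the indices, so it contains [a_n].  Modulo [a_n] the algebra
   consists of Laurent polynomials, and an ideal stable under the torus
   [x_i |-> t_i x_i] that contains a nonzero one contains a monomial, hence [1].
   This yields both [P = a_n] and, applied to [a_n] itself (a proper ideal), that
   no nonzero polynomial in the [x_i] lies in [a_n], so that [a_n] is prime.
   Finally [a_n] is stable under automorphisms because it is the ideal generated by
   all commutators, and [1 - x_i y_i <> 0] because [x_i], [y_i] can act on [K[X]] as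
   the two shifts [p |-> p X] and [p |-> p %/ X], the other generators acting as 1. *)
From HB Require Import structures.
From mathcomp Require Import all_boot all_order all_algebra.
From mathcomp Require Import fingroup perm.
From mathcomp Require Import boolp functions.
From mathcomp Require Import mpoly.
(* Required last: [functions] has another [image_eq]. *)
Require Import Defs.
Set Implicit Arguments. Unset Strict Implicit. Unset Printing Implicit Defensive.
Import Order.TTheory GRing.Theory.
Local Open Scope ring_scope.

(** * Subalgebras as algebras in their own right *)

Section SubAlgebra.
Variables (K : fieldType) (A : algType K) (S : subalgClosed A).
(** A closed predicate becomes an algebra, so that it can serve as the target in the universal
    property of the presentation. *)
Definition subalg_of : Type := {a : A | a \in S}.
HB.instance Definition _ := SubType.on subalg_of.
HB.instance Definition _ := [Choice of subalg_of by <:].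
HB.instance Definition _ := [SubChoice_isSubAlgebra of subalg_of by <:].
Definition subalg_incl : subalg_of -> A := val.
HB.instance Definition _ := GRing.RMorphism.copy subalg_incl (val : subalg_of -> A).
HB.instance Definition _ := GRing.Linear.copy subalg_incl (val : subalg_of -> A).
End SubAlgebra.

(** * The algebra of linear endomorphisms of [{poly K}] *)

Section EndoAlgebra.
Variable (K : fieldType).
Notation V := {poly K}.

(** Linearity as a boolean predicate lets the endomorphisms be carved out of the pointwise module
    [V -> V]; composition then supplies the product. *)
Definition linearb : {pred V -> V} := fun f => `[< linear f >].

Fact linearb_closed : submod_closed linearb.
Proof.
split; first by apply/asboolP => c u v; rewrite /= scaler0 addr0.
move=> a f g /asboolP fL /asboolP gL; apply/asboolP => c u v /=.
have addZE w : (a *: f + g) w = a *: f w + g w by [].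
rewrite !addZE fL gL !scalerDr !scalerA [a * c]mulrC -!addrA; congr (_ + _).
by rewrite addrCA.
Qed.
HB.instance Definition _ := GRing.isSubmodClosed.Build K (V -> V) linearb linearb_closed.

Definition endo : Type := {f : V -> V | f \in linearb}.
HB.instance Definition _ := SubType.on endo.
HB.instance Definition _ := [Choice of endo by <:].
HB.instance Definition _ := [SubChoice_isSubLmodule of endo by <:].

Lemma endoP (f : endo) : linear (val f).
Proof. by case: f => f /= /asboolP. Qed.

Lemma endo_ext (f g : endo) : val f =1 val g -> f = g.
Proof. by move=> fg; apply/val_inj/funext. Qed.

Definition endo_mk (f : V -> V) (fL : linear f) : endo := Sub f (asboolT fL).

Lemma endo_mul_subproof (f g : endo) : linear (val f \o val g).
Proof. by move=> c u v; rewrite /= !endoP. Qed.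
Lemma endo_id_subproof : linear (@id V).
Proof. by []. Qed.

Definition endo_mul f g := endo_mk (endo_mul_subproof f g).
Definition endo_one := endo_mk endo_id_subproof.

Fact endo_mulA : associative endo_mul.
Proof. by move=> f g h; apply: endo_ext. Qed.
Fact endo_mul1r : left_id endo_one endo_mul.
Proof. by move=> f; apply: endo_ext. Qed.
Fact endo_mulr1 : right_id endo_one endo_mul.
Proof. by move=> f; apply: endo_ext. Qed.
Fact endo_mulDl : left_distributive endo_mul +%R.
Proof. by move=> f g h; apply: endo_ext. Qed.
Fact endo_mulDr : right_distributive endo_mul +%R.
Proof.
move=> f g h; apply: endo_ext => v /=; rewrite !fctE /=.
by have := endoP f 1 (val g v) (val h v); rewrite !scale1r.
Qed.
Fact endo_1neq0 : endo_one != 0.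
Proof.
apply/eqP => /(congr1 (fun f : endo => val f 1)) /= /eqP.
by rewrite oner_eq0.
Qed.
HB.instance Definition _ := GRing.Zmodule_isNzRing.Build endo
  endo_mulA endo_mul1r endo_mulr1 endo_mulDl endo_mulDr endo_1neq0.
Fact endo_scaleAl (a : K) (f g : endo) : a *: (f * g) = (a *: f) * g.
Proof. exact: endo_ext. Qed.
HB.instance Definition _ := GRing.Lmodule_isLalgebra.Build K endo endo_scaleAl.
Fact endo_scaleAr (a : K) (f g : endo) : a *: (f * g) = f * (a *: g).
Proof.
apply: endo_ext => v /=; rewrite !fctE /=.
have f0 : val f 0 = 0.
  by have := endoP f (-1) 0 0; rewrite !scaleN1r !addNr.
by have := endoP f a (val g v) 0; rewrite f0 !addr0.
Qed.
HB.instance Definition _ := GRing.Lalgebra_isAlgebra.Build K endo endo_scaleAr.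

End EndoAlgebra.

(** * The two shifts, a one-sided inverse pair *)

Section BicyclicModel.
Variable (K : fieldType).
Fact shift_up_subproof : linear (fun p : {poly K} => p * 'X).
Proof. by move=> c p q; rewrite mulrDl scalerAl. Qed.
Fact shift_down_subproof : linear (fun p : {poly K} => p %/ 'X).
Proof. by move=> c p q; rewrite divpD divpZl. Qed.
Definition shift_up : endo K := endo_mk shift_up_subproof.
Definition shift_down : endo K := endo_mk shift_down_subproof.
Lemma shift_downK : shift_down * shift_up = 1.
Proof. by apply: endo_ext => p /=; rewrite mulpK ?polyX_eq0. Qed.
Lemma shift_upK : shift_up * shift_down != 1.
Proof.
(* Apply both sides to the polynomial 1 and evaluate at 0: a multiple of ['X] vanishes there, while
   1 does not. *)
apply/eqP => /(congr1 (fun f : endo K => (val f 1))) /= /(congr1 (horner^~ 0)).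
by rewrite hornerM hornerX mulr0 hornerC => /esym/eqP; rewrite oner_eq0.
Qed.
End BicyclicModel.

(** * Products over distinct indices in a noncommutative ring *)

Section NoncommutativeProducts.
Variables (R : nzRingType) (I : eqType).
Implicit Types (r : seq I) (F G : I -> R).

(** Each [G i] only has to pass the factors [F j] with [j != i], so [F i] and [G i] may fail to
    commute, as happens for powers of $x_i$ and $1 - x_i y_i$. *)
Lemma prodrM_comm_neq r F G : uniq r ->
    (forall i j, i != j -> GRing.comm (F i) (G j)) ->
  \prod_(i <- r) F i * \prod_(i <- r) G i = \prod_(i <- r) (F i * G i).
Proof.
move=> + FG; elim: r => [|i r IHr] /=; first by rewrite !big_nil mulr1.
case/andP=> i_r r_uniq; rewrite !big_cons -IHr // -!mulrA; congr (_ * _).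
rewrite !mulrA; congr (_ * _); apply/commr_sym; rewrite big_seq.
apply: commr_prod => j j_r; apply/commr_sym/FG.
by apply: contraNneq i_r => <-.
Qed.

Lemma prodr_eq0_mem r F i : i \in r -> F i = 0 -> \prod_(j <- r) F j = 0.
Proof.
move=> + Fi0; elim: r => // j r IHr; rewrite inE big_cons => /orP[/eqP <-|/IHr->].
  by rewrite Fi0 mul0r.
by rewrite mulr0.
Qed.

End NoncommutativeProducts.

(** * Two-sided ideals and the elementwise form of primeness *)

Section Ideals.
Variables (K : fieldType) (A : algType K) (I : A -> Prop).
Hypothesis I_ideal : is_ideal I.

Lemma is_ideal0 : I 0. Proof. by case: I_ideal. Qed.
Lemma is_idealD a b : I a -> I b -> I (a + b).
Proof. by case: I_ideal => _ + _; apply. Qed.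
Lemma is_idealMl r a : I a -> I (r * a).
Proof. by case: I_ideal => _ _ H /(H r)[]. Qed.
Lemma is_idealMr r a : I a -> I (a * r).
Proof. by case: I_ideal => _ _ H /(H r)[]. Qed.
Lemma is_idealZ c a : I a -> I (c *: a).
Proof. by move=> /(is_idealMl (c *: 1)); rewrite -scalerAl mul1r. Qed.
Lemma is_idealN a : I a -> I (- a).
Proof. by move/(is_idealZ (-1)); rewrite scaleN1r. Qed.
Lemma is_idealB a b : I a -> I b -> I (a - b).
Proof. by move=> Ia Ib; apply: is_idealD => //; apply: is_idealN. Qed.
Lemma is_ideal_sum (T : Type) (r : seq T) (F : T -> A) :
  (forall i, I (F i)) -> I (\sum_(i <- r) F i).
Proof. by move=> IF; apply: big_ind => //; [apply: is_ideal0 | apply: is_idealD]. Qed.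

End Ideals.

Lemma ideal_gen_ideal (R : pzRingType) (S : R -> Prop) : is_ideal (ideal_gen S).
Proof.
split=> [I [] //|a b Ha Hb I II SI|r a Ha].
  by case: (II) => _ + _; apply; [apply: Ha | apply: Hb].
by split=> I II SI; case: (II) => _ _ /(_ r a (Ha I II SI))[].
Qed.

(** With $R$ the whole ring, [U] consists of the $u$ with $uRb \subseteq P$ and [V] of the $v$ with
    $URv \subseteq P$. Both are ideals, $UV \subseteq P$, and $a \in U$, $b \in V$. *)
Lemma prime_ideal_elt (K : fieldType) (A : algType K) (P : A -> Prop) a b :
  is_prime_ideal P -> (forall r, P (a * r * b)) -> P a \/ P b.
Proof.
move=> [PI _ Pprime] Pab.
pose U u := forall r, P (u * r * b).
pose V v := forall u, U u -> forall r, P (u * r * v).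
have UI : is_ideal U.
  split=> [r|u u' Uu Uu' r|s u Uu].
  - by rewrite !mul0r; apply: is_ideal0.
  - by rewrite !mulrDl; apply: is_idealD; [| apply: Uu | apply: Uu'].
  - split=> r; last by rewrite -[u * s * r]mulrA.
    by rewrite -!mulrA; apply: is_idealMl => //; rewrite mulrA.
have VI : is_ideal V.
  split=> [u Uu r|v v' Vv Vv' u Uu r|s v Vv].
  - by rewrite mulr0; apply: is_ideal0.
  - by rewrite mulrDr; apply: is_idealD; [| apply: Vv | apply: Vv'].
  - split=> u Uu r; first by rewrite mulrA -[u * r * s]mulrA; apply: Vv.
    by rewrite mulrA; apply: is_idealMr => //; apply: Vv.
have [|UP|VP] := Pprime U V UI VI.
- by move=> u v Uu /(_ u Uu 1); rewrite mulr1.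
- by left; apply: UP.
- by right; apply: VP => u Uu r; apply: Uu.
Qed.

(** * Consequences of the universal property: induction and automorphisms *)

Section Presentation.
Variables (K : fieldType) (n : nat) (A : algType K) (x y : 'I_n -> A).
Hypothesis A_Sn : is_Sn x y.

(** The elements satisfying [D] form a subalgebra containing the generators. The universal map into
    it, followed by the inclusion, is the identity by uniqueness. *)
Lemma Sn_ind (D : A -> Prop) :
    D 1 -> (forall c a b, D a -> D b -> D (c *: a + b)) ->
    (forall a b, D a -> D b -> D (a * b)) ->
    (forall i, D (x i)) -> (forall i, D (y i)) ->
  forall a, D a.
Proof.
move=> D1 DL DM Dx Dy.
pose S : {pred A} := fun a => `[< D a >].
have SP a : reflect (D a) (a \in S) by apply: asboolP.
have S_closed : GRing.subalg_closed S.
  split; first exact/SP.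
  - by move=> c a b /SP Da /SP Db; apply/SP/DL.
  - by move=> a b /SP Da /SP Db; apply/SP/DM.
pose S_sub := GRing.isSubalgClosed.Build K A S S_closed.
pose SS : subalgClosed A := HB.pack S S_sub.
pose u i : subalg_of SS := Sub (x i) (introT (SP _) (Dx i)).
pose v i : subalg_of SS := Sub (y i) (introT (SP _) (Dy i)).
have [[yx comm] univ] := A_Sn.
have uv : Sn_rel u v.
  split=> [i|i j ij]; first by apply: val_inj; rewrite rmorphM rmorph1 /= yx.
  by have [? ? ?] := comm i j ij; split; apply: val_inj; rewrite !rmorphM.
have [f [fxy _]] := univ _ _ _ uv.
have [h [_ h_uniq]] := univ _ _ _ A_Sn.1.
move=> a; have -> : a = val (f a); last by apply/SP; exact: valP.
pose g : {lrmorphism A -> A} := @subalg_incl K A SS \o f.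
have -> : val (f a) = h a.
  apply: (h_uniq g) => i; rewrite /g /=.
  by have [-> ->] := fxy i.
exact: (h_uniq idfun).
Qed.

(** The elements whose left multiplication preserves [D] are closed under products, so [Sn_ind]
    applies to them; the result is then evaluated at 1. *)
Lemma Sn_left_ind (D : A -> Prop) :
    D 1 -> (forall c a b, D a -> D b -> D (c *: a + b)) ->
    (forall i a, D a -> D (x i * a)) -> (forall i a, D a -> D (y i * a)) ->
  forall a, D a.
Proof.
move=> D1 DL Dx Dy a; rewrite -[a]mulr1; move: a 1 D1.
apply: Sn_ind => [b|c a b Da Db b' Db'|a b Da Db b' Db'|//|//].
- by rewrite mul1r.
- by rewrite mulrDl -scalerAl; apply: DL; [apply: Da | apply: Db].
- by rewrite -mulrA; apply/Da/Db.
Qed.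

Lemma Sn_hom_ext (B : algType K) (f g : {lrmorphism A -> B}) :
  (forall i, f (x i) = g (x i)) -> (forall i, f (y i) = g (y i)) -> f =1 g.
Proof.
move=> fgx fgy; apply: Sn_ind => //; first by rewrite !rmorph1.
- by move=> c a b fga fgb; rewrite !linearP /= fga fgb.
- by move=> a b fga fgb; rewrite !rmorphM /= fga fgb.
Qed.

Lemma Sn_aut (f g : {lrmorphism A -> A}) :
    (forall i, f (g (x i)) = x i /\ f (g (y i)) = y i) ->
    (forall i, g (f (x i)) = x i /\ g (f (y i)) = y i) ->
  is_alg_aut f.
Proof.
move=> fg gf; exists g => a.
- by apply: (Sn_hom_ext (f := g \o f) (g := idfun)) => i /=; case: (gf i).
- by apply: (Sn_hom_ext (f := f \o g) (g := idfun)) => i /=; case: (fg i).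
Qed.

Lemma Sn_perm_aut (s : {perm 'I_n}) : exists f : {lrmorphism A -> A},
  is_alg_aut f /\ forall i, f (x i) = x (s i) /\ f (y i) = y (s i).
Proof.
have hom (t : {perm 'I_n}) : exists f : {lrmorphism A -> A},
    forall i, f (x i) = x (t i) /\ f (y i) = y (t i).
  have [] := A_Sn.2 A (x \o t) (y \o t); last by move=> f [fxy _]; exists f.
  split=> [i|i j ij] /=; first exact: A_Sn.1.1.
  by apply: A_Sn.1.2; rewrite (inj_eq perm_inj).
have [f f_xy] := hom s; have [g g_xy] := hom (s^-1)%g.
exists f; split=> //; apply: (Sn_aut (g := g)) => i.
  by have [-> ->] := g_xy i; have [-> ->] := f_xy ((s^-1)%g i); rewrite permKV.
by have [-> ->] := f_xy i; have [-> ->] := g_xy (s i); rewrite permK.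
Qed.

Lemma Sn_torus_aut (t : 'I_n -> K) : (forall i, t i != 0) ->
  exists f : {lrmorphism A -> A},
    is_alg_aut f /\ forall i, f (x i) = t i *: x i.
Proof.
move=> t0.
(* The $y_i$ are scaled by the inverses, which preserves $y_i x_i = 1$. *)
have hom (l : 'I_n -> K) : (forall i, l i != 0) -> exists f : {lrmorphism A -> A},
    forall i, f (x i) = l i *: x i /\ f (y i) = (l i)^-1 *: y i.
  move=> l0; have [] := A_Sn.2 A (fun i => l i *: x i) (fun i => (l i)^-1 *: y i);
    last by move=> f [fxy _]; exists f.
  split=> [i|i j ij] /=.
    by rewrite -scalerAl -scalerAr scalerA mulVf // scale1r A_Sn.1.1.
  have [xy xx yy] := A_Sn.1.2 i j ij.
  by split; rewrite -!scalerAl -!scalerAr !scalerA [X in X *: _]mulrC ?(xy, xx, yy).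
have [f f_xy] := hom t t0.
have [|g g_xy] := hom (fun i => (t i)^-1); first by move=> i; rewrite invr_eq0.
exists f; split=> [|i]; last by case: (f_xy i).
apply: (Sn_aut (g := g)) => i.
  have [gx gy] := g_xy i; have [fx fy] := f_xy i; rewrite gx gy !linearZ /= fx fy.
  by rewrite !scalerA ?invrK ?mulVf ?mulfV // !scale1r.
have [gx gy] := g_xy i; have [fx fy] := f_xy i; rewrite fx fy !linearZ /= gx gy.
by rewrite !scalerA ?invrK ?mulVf ?mulfV // !scale1r.
Qed.

End Presentation.

(** * Monomials, the idempotents $1 - x_i y_i$, and normal forms *)

Section Monomials.
Variables (K : fieldType) (n : nat) (A : algType K) (x y : 'I_n -> A).
Hypothesis A_Sn : is_Sn x y.

Local Notation X m := (mmap1 x m).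
Local Notation Y m := (mmap1 y m).
Local Notation e i := (1 - x i * y i).
Local Notation E := (\prod_(i < n) (1 - x i * y i)).
(** [ev] substitutes the $x_i$ into a polynomial. [ev2] takes a polynomial with polynomial
    coefficients and writes the coefficients, in the $x_i$, to the left of the monomials in the
    $y_i$. *)
Local Notation ev := (mmap (in_alg A) x).
Local Notation ev2 := (mmap ev y).

Lemma yxK i : y i * x i = 1. Proof. exact: A_Sn.1.1. Qed.

Lemma xxC i j : GRing.comm (x i) (x j).
Proof. by have [->//|/(A_Sn.1.2 i j)[]] := eqVneq i j. Qed.

Lemma yyC i j : GRing.comm (y i) (y j).
Proof. by have [->//|/(A_Sn.1.2 i j)[]] := eqVneq i j. Qed.

Lemma xyC i j : i != j -> GRing.comm (x i) (y j).
Proof. by case/(A_Sn.1.2 i j). Qed.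

Lemma ye0 i : y i * e i = 0.
Proof. by rewrite mulrBr mulr1 mulrA yxK mul1r subrr. Qed.

Lemma ex0 i : e i * x i = 0.
Proof. by rewrite mulrBl mul1r -mulrA yxK mulr1 subrr. Qed.

Lemma ee i : e i * e i = e i.
Proof. by rewrite mulrBr mulr1 mulrA ex0 mul0r subr0. Qed.

Lemma comm_e (i : 'I_n) a :
  GRing.comm a (x i) -> GRing.comm a (y i) -> GRing.comm a (e i).
Proof. by move=> ax ay; apply: commrB; [apply: commr1 | apply: commrM]. Qed.

Lemma xeC i j : i != j -> GRing.comm (x i) (e j).
Proof. by move=> ij; apply: comm_e; [apply: xxC | apply: xyC]. Qed.

Lemma yeC i j : i != j -> GRing.comm (y i) (e j).
Proof.
move=> ij; apply: comm_e; last exact: yyC.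
by apply/commr_sym/xyC; rewrite eq_sym.
Qed.

Lemma eeC i j : i != j -> GRing.comm (e i) (e j).
Proof.
by move=> ij; apply: comm_e; apply/commr_sym; [apply: xeC | apply: yeC];
  rewrite eq_sym.
Qed.

Lemma yxnK i k : y i ^+ k * x i ^+ k = 1.
Proof.
elim: k => [|k IHk]; first by rewrite !expr0 mulr1.
by rewrite exprSr exprS mulrA -[_ * y i * x i]mulrA yxK mulr1.
Qed.

Lemma yxe_lt i k m : (m < k)%N -> y i ^+ k * (x i ^+ m * e i) = 0.
Proof.
move=> mk; rewrite -(subnK mk) addnS -addSn exprD mulrA.
rewrite -[_ * _ * x i ^+ m]mulrA yxnK mulr1 exprSr -mulrA.
by rewrite ye0 mulr0.
Qed.

(** This is the multiplication rule of the matrix units $E_{kl}(i) = x_i^k (1 - x_i y_i) y_i^l$: the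
    surplus $x_i$ or $y_i$ is annihilated by the idempotent next to it. *)
Lemma eyxe i k m : e i * (y i ^+ k * (x i ^+ m * e i)) = (k == m)%:R * e i.
Proof.
case: ltngtP => [km|mk|->]; last by rewrite [Z in _ * Z]mulrA yxnK !mul1r ee.
  rewrite mul0r -(subnKC km) addSn -addnS exprD !mulrA -[_ * _ * x i ^+ k]mulrA.
  by rewrite yxnK mulr1 exprS mulrA ex0 !mul0r.
by rewrite yxe_lt // mulr0 mul0r.
Qed.

Lemma prodr_ord_comm_neq (F G : 'I_n -> A) :
    (forall i j, i != j -> GRing.comm (F i) (G j)) ->
  \prod_(i < n) F i * \prod_(i < n) G i = \prod_(i < n) (F i * G i).
Proof. by move=> FG; apply: prodrM_comm_neq => //; apply: index_enum_uniq. Qed.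

Lemma xnenC i j k : i != j -> GRing.comm (x i ^+ k) (e j).
Proof. by move=> ij; apply/commr_sym/commrX/commr_sym/xeC. Qed.

Lemma ynxneC i j k m : i != j -> GRing.comm (y i ^+ k) (x j ^+ m * e j).
Proof.
move=> ij; apply/commr_sym/commrX/commr_sym.
apply: commrM; last exact: yeC.
by apply/commrX/commr_sym/xyC; rewrite eq_sym.
Qed.

Lemma XE m : X m * E = \prod_(i < n) (x i ^+ m i * e i).
Proof. by rewrite prodr_ord_comm_neq // => i j; apply: xnenC. Qed.

Lemma YXE k m : Y k * (X m * E) = \prod_(i < n) (y i ^+ k i * (x i ^+ m i * e i)).
Proof. by rewrite XE prodr_ord_comm_neq // => i j; apply: ynxneC. Qed.

Lemma YXE_id m : Y m * (X m * E) = E.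
Proof. by rewrite YXE; apply: eq_bigr => i _; rewrite mulrA yxnK mul1r. Qed.

Lemma YXE_eq0 k m : ~~ (k <= m)%MM -> Y k * (X m * E) = 0.
Proof.
move=> /mnm_lepP/existsNP[i /negP]; rewrite -ltnNge YXE => mk.
by apply: (@prodr_eq0_mem _ _ _ _ i); [apply: mem_index_enum | apply: yxe_lt].
Qed.

(** The product splits into one factor for each index, and [eyxe] evaluates each of them. *)
Lemma EYXE k m : E * (Y k * (X m * E)) = (k == m)%:R * E.
Proof.
have -> : E * (Y k * (X m * E)) = \prod_(i < n) ((k i == m i)%:R * e i).
  rewrite YXE prodr_ord_comm_neq => [|i j ij].
    by apply: eq_bigr => i _; apply: eyxe.
  apply/commrM; last apply/commrM; last exact: eeC.
    by apply/commrX/commr_sym/yeC; rewrite eq_sym.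
  by apply/commrX/commr_sym/xeC; rewrite eq_sym.
have [->|km] := eqVneq k m.
  by rewrite mul1r; apply: eq_bigr => i _; rewrite eqxx mul1r.
have /existsNP[i /eqP kmi] : ~ forall i, k i = m i by move/mnmP/eqP; apply/negP.
rewrite mul0r; apply: (@prodr_eq0_mem _ _ _ _ i); first exact: mem_index_enum.
by rewrite (negPf kmi) mul0r.
Qed.

Lemma XD m k : X (m + k) = X m * X k.
Proof.
rewrite prodr_ord_comm_neq => [|i j _].
  by apply: eq_bigr => i _; rewrite mnmDE exprD.
by apply/commrX/commr_sym/commrX/xxC.
Qed.

Lemma YD m k : Y (m + k) = Y m * Y k.
Proof.
rewrite prodr_ord_comm_neq => [|i j _].
  by apply: eq_bigr => i _; rewrite mnmDE exprD.
by apply/commrX/commr_sym/commrX/yyC.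
Qed.

Lemma YXK m : Y m * X m = 1.
Proof.
rewrite prodr_ord_comm_neq => [|i j ij].
  by rewrite big1 // => i _; apply: yxnK.
by apply/commrX/commr_sym/commrX/xyC; rewrite eq_sym.
Qed.

Lemma evX m : ev 'X_[m] = X m. Proof. exact: mmapX. Qed.

Lemma evZ c p : ev (c *: p) = c *: ev p.
Proof. by rewrite mmapZ /= mulr_algl. Qed.

Lemma evE p : ev p = \sum_(m <- msupp p) p@_m *: X m.
Proof. by apply: eq_bigr => m _; rewrite mulr_algl. Qed.

Lemma evM p q : ev (p * q) = ev p * ev q.
Proof.
rewrite {1}(mpolyE p) {1}(mpolyE q) mulr_suml raddf_sum [ev p]evE mulr_suml.
apply: eq_bigr => m _; rewrite mulr_sumr raddf_sum [ev q]evE mulr_sumr.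
apply: eq_bigr => k _.
rewrite /= -[in LHS]scalerAl -[in LHS]scalerAr -mpolyXD 2!evZ evX XD.
by rewrite -[in RHS]scalerAl -[in RHS]scalerAr.
Qed.

Lemma ev1 : ev 1 = 1. Proof. by rewrite -mpolyX0 evX mmap11. Qed.

Lemma ev2E q : ev2 q = \sum_(m <- msupp q) ev q@_m * Y m.
Proof. by []. Qed.

Lemma ev2CX p m : ev2 (p *: 'X_[m]) = ev p * Y m.
Proof.
have [->|p0] := eqVneq p 0; first by rewrite scale0r !raddf0 mul0r.
by rewrite ev2E msuppMCX // big_seq1 mcoeffZ mcoeffX eqxx mulr1.
Qed.

Lemma ev2_left p q : ev2 (p *: q) = ev p * ev2 q.
Proof.
rewrite {1}[q]mpolyE scaler_sumr [LHS]raddf_sum ev2E mulr_sumr.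
apply: eq_bigr => m _ /=.
by rewrite scalerA ev2CX evM mulrA.
Qed.

End Monomials.

(** * Nonzero ideals and the idempotents in a prime *)

Section NonzeroIdeals.
Variables (K : fieldType) (n : nat) (A : algType K) (x y : 'I_n -> A).
Hypothesis A_Sn : is_Sn x y.

Local Notation X m := (mmap1 x m).
Local Notation Y m := (mmap1 y m).
Local Notation e i := (1 - x i * y i).
Local Notation E := (\prod_(i < n) (1 - x i * y i)).
Local Notation ev := (mmap (in_alg A) x).
Local Notation ev2 := (mmap ev y).

Lemma yX_cancel_or_comm i k : (exists l, y i * X k = X l) \/ y i * X k = X k * y i.
Proof.
have [ki0|ki_gt0] := posnP (k i).
  right; apply: commr_prod => j _; have [<-|ij] := eqVneq i j.
    by rewrite ki0 expr0; apply: commr1.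
  by apply/commrX/commr_sym/(xyC A_Sn); rewrite eq_sym.
left; exists (k - U_(i))%MM.
have {1}-> : k = (U_(i) + (k - U_(i)))%MM.
  by rewrite addmC submK // lep1mP -lt0n.
by rewrite (XD A_Sn) mmap1U mulrA (yxK A_Sn) mul1r.
Qed.

(** The span of the monomials [X k * Y m] is stable under left multiplication by the generators.
    Only $y_i$ needs care: it cancels an $x_i$ of [X k], or commutes with [X k] and joins [Y m]. *)
Lemma monomial_span a : exists q, a = ev2 q.
Proof.
pose Span b := exists q, b = ev2 q; rewrite -/(Span a).
have span_lin c b1 b2 : Span b1 -> Span b2 -> Span (c *: b1 + b2).
  move=> [q ->] [r ->]; exists (c%:MP *: q + r).
  by rewrite raddfD /= (ev2_left A_Sn) mmapC mulr_algl.
have span0 : Span 0 by exists 0; rewrite raddf0.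
have spanD b1 b2 : Span b1 -> Span b2 -> Span (b1 + b2).
  by rewrite -{2}[b1]scale1r; apply: span_lin.
have spanXY k m : Span (X k * Y m).
  by exists ('X_[k] *: 'X_[m]); rewrite ev2CX evX.
move: a; apply: (Sn_left_ind A_Sn) => [|//|i _ [q ->]|i _ [q ->]].
- by have [q qE] := spanXY 0%MM 0%MM; exists q; rewrite -qE !mmap11 mulr1.
- by exists ('X_i *: q); rewrite (ev2_left A_Sn) evX mmap1U.
rewrite ev2E mulr_sumr; apply: (big_ind Span) => // m _.
rewrite evE mulr_suml mulr_sumr; apply: (big_ind Span) => // k _.
rewrite -scalerAl -scalerAr -[_ *: _]addr0; apply: span_lin => //.
rewrite mulrA; have [[l ->]|->] := yX_cancel_or_comm i k; first exact: spanXY.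
rewrite -mulrA -{1}(mmap1U y i) -(YD A_Sn); exact: spanXY.
Qed.

(* Multiplying [a = sum_m ev q_m * Y m] on the right by [X m0 * E], [m0] minimal,
   leaves [ev q_(m0) * E]; multiplying then on the left by [E * Y k] extracts the
   [k]-th coefficient of [q_(m0)]. *)
Lemma nonzero_ideal_contains_prod (I : A -> Prop) a :
  is_ideal I -> I a -> a <> 0 -> I E.
Proof.
move=> I_ideal + a0; have [q aE] := monomial_span a; rewrite {a}aE in a0 * => Ia.
have q0 : q != 0 by apply/eqP => q0; apply: a0; rewrite q0 raddf0.
have qm0 : q@_(mlast q) != 0 by rewrite -mcoeff_msupp mlast_supp.
set p := q@_(mlast q) in qm0.
have evpE : ev2 q * (X (mlast q) * E) = ev p * E.
  rewrite ev2E mulr_suml (bigD1_seq (mlast q)) ?msupp_uniq ?mlast_supp //=.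
  rewrite -mulrA (YXE_id A_Sn) [Z in _ + Z]big_seq_cond.
  rewrite [Z in _ + Z]big1 ?addr0 // => m /andP[mq mm].
  rewrite -mulrA (YXE_eq0 A_Sn) ?mulr0 //; apply: contra mm => mle.
  by rewrite eq_le (lem_leo mle) (mlast_lemc mq).
have IpE : I (ev p * E) by rewrite -evpE; exact: (is_idealMr I_ideal _ Ia).
have := is_idealMl I_ideal E (is_idealMl I_ideal (Y (mlead p)) IpE).
rewrite evE mulr_suml 2!mulr_sumr.
rewrite (bigD1_seq (mlead p)) ?msupp_uniq ?mlead_supp //=.
rewrite -scalerAl -scalerAr -scalerAr (EYXE A_Sn) eqxx mul1r.
rewrite [Z in _ + Z]big1 => [|m mp].
  rewrite addr0 => /(is_idealZ I_ideal (p@_(mlead p))^-1).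
  by rewrite scalerA mulVf ?scale1r // mleadc_eq0.
by rewrite -scalerAl -!scalerAr (EYXE A_Sn) eq_sym (negPf mp) mul0r scaler0.
Qed.

Lemma prime_contains_factor (P : A -> Prop) (r : seq 'I_n) : is_prime_ideal P ->
  uniq r -> P (\prod_(i <- r) e i) -> exists i, P (e i).
Proof.
move=> P_prime; have [P_ideal P1 _] := P_prime.
elim: r => [_|i r IHr /= /andP[i_r r_uniq]]; first by rewrite big_nil => /P1.
rewrite big_cons; set F := \prod_(j <- r) _ => PiF.
suff [Pi|PF] : P (e i) \/ P F by [exists i | apply: IHr].
(* It remains to show $(1 - x_i y_i) a F \in P$ for every $a$. The letters of $a$ are processed from
   the left: those of index $i$ are collected in [t], the others commute with $1 - x_i y_i$ and [t]
   and move to the front. At the end [t] commutes with [F], which involves only other indices. *)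
apply: prime_ideal_elt => // a.
pose C (t : A) := forall j, j != i -> GRing.comm t (x j) /\ GRing.comm t (y j).
have C1 : C 1 by move=> j _; split; apply/commr_sym/commr1.
suff: forall t, C t -> P (e i * t * a * F) by move=> /(_ 1 C1); rewrite mulr1.
move: a; apply: (Sn_left_ind A_Sn) => [t tC|c a b Pa Pb t tC|j a Pa t tC|j a Pa t tC].
- have tF : GRing.comm t F.
    rewrite /F big_seq; apply: commr_prod => j j_r.
    have [|tx ty] := tC j; first by apply: contraNneq i_r => <-.
    exact: comm_e.
  by rewrite mulr1 -mulrA tF mulrA; apply: is_idealMr.
- rewrite mulrDr mulrDl -scalerAr -scalerAl; apply: is_idealD => //; last exact: Pb.
  by apply: is_idealZ => //; apply: Pa.
- have [->|ji] := eqVneq j i.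
    rewrite mulrA -[e i * t * _]mulrA; apply: Pa => k ki; have [tx ty] := tC k ki.
    split; apply/commr_sym/commrM; [exact: commr_sym | exact: (xxC A_Sn) |
      exact: commr_sym | by apply/commr_sym/(xyC A_Sn); rewrite eq_sym].
  have [tx ty] := tC j ji.
  have -> : e i * t * (x j * a) * F = x j * (e i * t * a * F).
    by rewrite !mulrA (xeC A_Sn ji) -[in RHS](mulrA (e i)) -tx !mulrA.
  by apply: is_idealMl => //; apply: Pa.
- have [->|ji] := eqVneq j i.
    rewrite mulrA -[e i * t * _]mulrA; apply: Pa => k ki; have [tx ty] := tC k ki.
    split; apply/commr_sym/commrM; [exact: commr_sym | exact: (xyC A_Sn) |
      exact: commr_sym | exact: (yyC A_Sn)].
  have [tx ty] := tC j ji.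
  have -> : e i * t * (y j * a) * F = y j * (e i * t * a * F).
    by rewrite !mulrA (yeC A_Sn ji) -[in RHS](mulrA (e i)) -ty !mulrA.
  by apply: is_idealMl => //; apply: Pa.
Qed.

End NonzeroIdeals.

(** Makes 2 a torus parameter that separates all exponents. *)
Lemma pchar0_exprn2_inj (K : fieldType) : [pchar K] =i pred0 ->
  injective (fun k => 2 ^+ k : K).
Proof.
move=> /pcharf0P K0 k l /eqP; wlog kl : k l / (k <= l)%N => [wl|].
  case/orP: (leq_total k l) => kl; first exact: wl.
  by rewrite eq_sym => lk; apply/esym/wl.
rewrite eq_sym -subr_eq0 -!natrX -natrB ?leq_exp2l // K0 subn_eq0 leq_exp2l //.
by move=> lk; apply/eqP; rewrite eqn_leq kl.
Qed.

(** * The ideal $\mathfrak{a}_n$: invariance, primeness and uniqueness *)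

Section CommutatorIdeal.
Variables (K : fieldType) (n : nat) (A : algType K) (x y : 'I_n -> A).
Hypothesis A_Sn : is_Sn x y.

Local Notation X m := (mmap1 x m).
Local Notation Y m := (mmap1 y m).
Local Notation e i := (1 - x i * y i).
Local Notation ev := (mmap (in_alg A) x).

Lemma a_ideal_ideal : is_ideal (a_ideal x y).
Proof.
have pI i : is_ideal (p_ideal x y i) by apply: ideal_gen_ideal.
split.
- by exists (fun=> 0); split=> [i|]; [exact: (is_ideal0 (pI i)) | rewrite big1].
- move=> _ _ [f [fP ->]] [g [gP ->]]; exists (fun i => f i + g i).
  by rewrite big_split; split=> // i; apply: (is_idealD (pI i)).
- move=> r _ [f [fP ->]]; split.
    by exists (fun i => r * f i); rewrite mulr_sumr; split=> // i;
      apply: (is_idealMl (pI i)).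
  by exists (fun i => f i * r); rewrite mulr_suml; split=> // i;
    apply: (is_idealMr (pI i)).
Qed.

Lemma a_ideal_mem i : a_ideal x y (e i).
Proof.
exists (fun j => if j == i then e i else 0); split=> [j|].
  case: eqP => [->|_]; first by move=> I _; apply.
  exact: (is_ideal0 (ideal_gen_ideal _)).
by rewrite -big_mkcond big_pred1_eq.
Qed.

Lemma a_ideal_min (I : A -> Prop) :
  is_ideal I -> (forall i, I (e i)) -> forall a, a_ideal x y a -> I a.
Proof.
move=> I_ideal Ie _ [f [fP ->]]; apply: is_ideal_sum => // i.
by apply: fP => // _ ->.
Qed.

(** Since $[\cdot, b]$ is a derivation, the elements commuting with [b] modulo [I] form a
    subalgebra. *)
Lemma comm_mod_ind (I : A -> Prop) b : is_ideal I ->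
    (forall i, I (x i * b - b * x i)) -> (forall i, I (y i * b - b * y i)) ->
  forall a, I (a * b - b * a).
Proof.
move=> I_ideal Ix Iy; apply: (Sn_ind A_Sn) => //.
- by rewrite mul1r mulr1 subrr; apply: is_ideal0.
- move=> c a a' Ia Ia'.
  rewrite mulrDl mulrDr -scalerAl -scalerAr opprD addrACA -scalerBr.
  by apply: is_idealD => //; apply: is_idealZ.
- move=> a a' Ia Ia'.
  have -> : a * a' * b - b * (a * a') = a * (a' * b - b * a') + (a * b - b * a) * a'.
    by rewrite mulrBr mulrBl !mulrA addrA subrK.
  by apply: is_idealD => //; [apply: is_idealMl | apply: is_idealMr].
Qed.

(** [comm_mod_ind] in each argument reduces to generators, where the only nonzero commutators are
    $\pm[x_i, y_i] = \mp(1 - x_i y_i)$. *)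
Lemma comm_mod_a_ideal a b : a_ideal x y (a * b - b * a).
Proof.
have aI := a_ideal_ideal.
have commI (c d : A) : GRing.comm c d -> a_ideal x y (c * d - d * c).
  by move=> ->; rewrite subrr; apply: (is_ideal0 aI).
have swap c d : a_ideal x y (c * d - d * c) -> a_ideal x y (d * c - c * d).
  by move/(is_idealN aI); rewrite opprB.
have xy i j : a_ideal x y (x i * y j - y j * x i).
  have [->|ij] := eqVneq i j; last exact/commI/(xyC A_Sn).
  by rewrite (yxK A_Sn) -opprB; apply: (is_idealN aI); apply: a_ideal_mem.
apply: (comm_mod_ind aI) => i; apply/swap; apply: (comm_mod_ind aI) => j.
- exact/commI/(xxC A_Sn).
- exact/swap/xy.
- exact: xy.
- exact/commI/(yyC A_Sn).
Qed.

Lemma a_ideal_aut (s : {lrmorphism A -> A}) :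
  is_alg_aut s -> image_eq s (a_ideal x y).
Proof.
have aI := a_ideal_ideal.
have eE i : e i = y i * x i - x i * y i by rewrite (yxK A_Sn).
case=> s' sK s'K b; split=> [ab|[a [Pa <-]]].
  (* The image of $\mathfrak{a}_n$ is an ideal, and it contains $1 - x_i y_i = [y_i, x_i]$ as the
     image of the commutator of the preimages. *)
  pose J (b : A) := exists a, a_ideal x y a /\ s a = b.
  apply: (a_ideal_min (I := J)) ab => [|i].
    split=> [|_ _ [a [Pa <-]] [a' [Pa' <-]]|r _ [a [Pa <-]]].
    - by exists 0; rewrite rmorph0; split=> //; apply: (is_ideal0 aI).
    - by exists (a + a'); rewrite rmorphD; split=> //; apply: (is_idealD aI).
    - split; [exists (s' r * a) | exists (a * s' r)]; rewrite rmorphM /= s'K; split=> //.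
        exact: (is_idealMl aI).
      exact: (is_idealMr aI).
  exists (s' (y i) * s' (x i) - s' (x i) * s' (y i)); split.
    exact: comm_mod_a_ideal.
  by rewrite rmorphB !rmorphM /= !s'K eE.
apply: (a_ideal_min (I := fun a => a_ideal x y (s a))) Pa => [|i].
  split=> [|u v Pu Pv|r u Pu].
  - by rewrite rmorph0; apply: (is_ideal0 aI).
  - by rewrite rmorphD; apply: (is_idealD aI).
  - by split; rewrite rmorphM; [apply: (is_idealMl aI) | apply: (is_idealMr aI)].
by rewrite eE rmorphB !rmorphM; apply: comm_mod_a_ideal.
Qed.

(** Modulo $\mathfrak{a}_n$ each $y_i$ is a two-sided inverse of $x_i$, so [a] becomes a Laurent
    polynomial and a monomial clears its denominators. *)
Lemma clear_denominators a :
  exists m p, a_ideal x y (X m * a - ev p).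
Proof.
have aI := a_ideal_ideal.
move: a; apply: (Sn_left_ind A_Sn) =>
  [|c a b [m [p Ia]] [k [q Ib]]|i a [m [p Ia]]|i a [m [p Ia]]].
- by exists 0%MM, 1; rewrite mmap11 (ev1 x) mulr1 subrr; apply: (is_ideal0 aI).
- exists (k + m)%MM, (c *: ('X_[k] * p) + 'X_[m] * q).
  rewrite raddfD /= evZ !(evM A_Sn) !evX mulrDr -scalerAr opprD addrACA -scalerBr.
  apply: (is_idealD aI) => //.
    by apply: (is_idealZ aI) => //; rewrite (XD A_Sn) -mulrA -mulrBr; apply: (is_idealMl aI).
  by rewrite addmC (XD A_Sn) -mulrA -mulrBr; apply: (is_idealMl aI).
- exists m, ('X_i * p); rewrite (evM A_Sn) evX mmap1U mulrA -{1}(mmap1U x i).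
  by rewrite -(XD A_Sn) addmC (XD A_Sn) mmap1U -mulrA -mulrBr; apply: (is_idealMl aI).
- exists (m + U_(i))%MM, p; rewrite (XD A_Sn) mmap1U.
  have -> : X m * x i * (y i * a) - ev p = X m * a - ev p - X m * e i * a.
    by rewrite mulrBr mulr1 mulrBl !mulrA opprB [RHS]addrC addrA subrK.
  apply: (is_idealB aI) => //; apply: (is_idealMr aI) => //; apply: (is_idealMl aI) => //.
  exact: a_ideal_mem.
Qed.

Lemma clear_denominators0 m a : a_ideal x y (X m * a) -> a_ideal x y a.
Proof.
move/(is_idealMl a_ideal_ideal (Y m)).
by rewrite mulrA (YXK A_Sn) mul1r.
Qed.

Hypothesis charK0 : [pchar K] =i pred0.

(* Applying [x_i |-> 2 x_i] and subtracting [2 ^+ m i] times the original kills the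
   monomial [m] while keeping every monomial whose exponent at [i] differs. *)
Lemma invariant_ideal_poly (I : A -> Prop) p : is_ideal I ->
    (forall s : {lrmorphism A -> A}, is_alg_aut s -> forall a, I a -> I (s a)) ->
  p != 0 -> I (ev p) -> I 1.
Proof.
move=> I_ideal I_inv; move: {2}(size _) (leqnn (size (msupp p))) => N.
elim: N p => [|N IHN] p; first by rewrite leqn0 size_eq0 msupp_eq0 => ->.
move=> size_p p0 Ip.
have [m mp] : exists m, m \in msupp p by exists (mlead p); apply: mlead_supp.
have pm0 : p@_m != 0 by rewrite -mcoeff_msupp.
(* If [m] is the only monomial of [p], then [Y m] and a scalar turn [ev p] into 1. Otherwise some
   monomial [k] differs from [m] at an index [i], and it survives in the shorter polynomial [q]
   below. *)
have [/hasP[k kp /= km]|/hasPn pm] := boolP (has (predC1 m) (msupp p)); last first.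
  have pE : p = p@_m *: 'X_[m].
    rewrite {1}[p]mpolyE (bigD1_seq m) ?msupp_uniq //= big_seq_cond big1 ?addr0 //.
    by move=> k /andP[/pm /=]; case: eqP.
  have := is_idealZ I_ideal (p@_m)^-1 (is_idealMl I_ideal (Y m) Ip).
  by rewrite {2}pE evZ evX -scalerAr (YXK A_Sn) scalerA mulVf // scale1r.
have /existsNP[i /eqP kmi] : ~ forall i, k i = m i by move/mnmP/eqP; apply/negP.
pose t (j : 'I_n) : K := if j == i then 2 else 1.
have two0 : 2 != 0 :> K by move/pcharf0P: charK0 => ->.
have [|s [s_aut sx]] := Sn_torus_aut A_Sn (t := t).
  by move=> j; rewrite /t; case: (j == i); [exact: two0 | exact: oner_neq0].
have sX l : s (X l) = 2 ^+ l i *: X l.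
  rewrite rmorph_prod (eq_bigr (fun j => t j ^+ l j *: x j ^+ l j)) => [|j _].
    rewrite scaler_prod (bigD1 i) //= /t eqxx big1 ?mulr1 // => j ji.
    by rewrite (negPf ji) expr1n.
  by rewrite rmorphXn /= sx exprZn.
pose q := \sum_(l <- msupp p) (p@_l * (2 ^+ l i - 2 ^+ m i)) *: 'X_[l].
have qE l : q@_l = p@_l * (2 ^+ l i - 2 ^+ m i).
  rewrite raddf_sum /=; have [lp|lp] := boolP (l \in msupp p).
    rewrite (bigD1_seq l) ?msupp_uniq //= mcoeffZ mcoeffX eqxx mulr1.
    rewrite big1 ?addr0 // => j jl.
    by rewrite mcoeffZ mcoeffX (negPf jl) mulr0.
  rewrite (memN_msupp_eq0 lp) mul0r big_seq big1 // => j jp.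
  rewrite mcoeffZ mcoeffX; case: eqP => [jl|_]; last by rewrite mulr0.
  by rewrite jl (negPf lp) in jp.
apply: (IHN q).
- rewrite -ltnS; apply: leq_trans size_p.
  rewrite (perm_size (perm_to_rem mp)) /= ltnS.
  apply: uniq_leq_size => [|l]; first exact: msupp_uniq.
  rewrite mcoeff_msupp qE mulf_eq0 negb_or -mcoeff_msupp => /andP[lp lm].
  rewrite mem_rem_uniq ?msupp_uniq // inE lp andbT.
  by apply: contraNneq lm => ->; rewrite subrr.
- have : q@_k != 0; last by apply: contraNneq => ->; rewrite mcoeff0.
  rewrite qE mulf_neq0 -?mcoeff_msupp // subr_eq0.
  by apply: contraNneq kmi => /(pchar0_exprn2_inj charK0) ->.
- have -> : ev q = s (ev p) - 2 ^+ m i *: ev p.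
    rewrite raddf_sum evE raddf_sum scaler_sumr -sumrB; apply: eq_bigr => l _ /=.
    rewrite evZ evX linearZ /= sX !scalerA -scalerBl [2 ^+ m i * _]mulrC.
    by rewrite mulrBr.
  apply: is_idealB => //; last exact: is_idealZ.
  exact: I_inv.
Qed.

Lemma a_ideal_proper : ~ a_ideal x y 1.
Proof.
(* The character sending every generator to 1 kills each $1 - x_i y_i$, hence $\mathfrak{a}_n$, but
   not 1. *)
have [|f [fxy _]] := A_Sn.2 K^o (fun=> 1) (fun=> 1).
  by split=> [i|i j _]; rewrite mulr1.
move=> a1; suff : f 1 = 0 by rewrite rmorph1 => /eqP; rewrite oner_eq0.
apply: (a_ideal_min (I := fun a => f a = 0)) a1 => [|i].
  split=> [|a b fa fb|r a fa]; first exact: rmorph0.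
    by rewrite rmorphD /= fa fb addr0.
  by rewrite !rmorphM /= fa mulr0 mul0r.
by have [fx fy] := fxy i; rewrite rmorphB rmorphM rmorph1 /= fx fy mulr1 subrr.
Qed.

Lemma a_ideal_prime : is_prime_ideal (a_ideal x y).
Proof.
have aI := a_ideal_ideal.
split=> // [|I J I_ideal J_ideal IJ]; first exact: a_ideal_proper.
apply/or_asboolP; rewrite -[_ || _]negbK negb_or; apply/negP => /andP[].
move=> /asboolPn/existsNP[a /not_implyP[Ia Na]].
move=> /asboolPn/existsNP[b /not_implyP[Jb Nb]].
have [m [p Ip]] := clear_denominators a; have [k [q Iq]] := clear_denominators b.
have nz c l r : a_ideal x y (X l * c - ev r) -> ~ a_ideal x y c -> r != 0.
  move=> Ic Nc; apply/eqP => r0; apply: Nc; apply: (@clear_denominators0 l).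
  by move: Ic; rewrite r0 raddf0 subr0.
(* If neither ideal lay in $\mathfrak{a}_n$, the nonzero polynomial [p * q] would give an element of
   $\mathfrak{a}_n$, and torus invariance would put 1 there. *)
apply: a_ideal_proper; apply: (@invariant_ideal_poly _ (p * q)) => //.
- by move=> s /a_ideal_aut sP c Pc; apply/sP; exists c.
- by rewrite mulf_neq0 ?(nz _ _ _ Ip) ?(nz _ _ _ Iq).
rewrite (evM A_Sn) -[ev p * _](subrK (X m * a * (X k * b))).
apply: (is_idealD aI) => //; last first.
  by apply: IJ; [apply: (is_idealMl I_ideal) | apply: (is_idealMl J_ideal)].
have -> : ev p * ev q - X m * a * (X k * b) =
    - ((X m * a - ev p) * (X k * b) + ev p * (X k * b - ev q)).
  by rewrite mulrBl mulrBr addrA subrK opprB.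
apply: (is_idealN aI); apply: (is_idealD aI);
  [exact: (is_idealMr aI) | exact: (is_idealMl aI)].
Qed.

Lemma e_neq0 i : e i <> 0.
Proof.
pose u j : endo K := if j == i then shift_up K else 1.
pose v j : endo K := if j == i then shift_down K else 1.
have [|f [fxy _]] := A_Sn.2 (endo K) u v.
  split=> [j|j k jk]; rewrite /u /v.
    by case: eqP => _; [apply: shift_downK | apply: mulr1].
  (* Of two distinct indices at least one differs from [i], and its generators act as 1. *)
  have : ~~ ((j == i) && (k == i)).
    by apply: contra jk => /andP[/eqP-> /eqP->].
  by case: (j == i); case: (k == i) => //= _; rewrite !mulr1 !mul1r.
move/(congr1 f); rewrite rmorph0 rmorphB rmorph1 rmorphM /=.
have [-> ->] := fxy i; rewrite /u /v eqxx => /eqP.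
by rewrite subr_eq0 eq_sym (negPf (shift_upK K)).
Qed.

Lemma invariant_prime_eq (P : A -> Prop) : is_prime_ideal P ->
    (exists a, P a /\ a <> 0) ->
    (forall s : {lrmorphism A -> A}, is_alg_aut s -> image_eq s P) ->
  forall a, P a <-> a_ideal x y a.
Proof.
move=> P_prime [a0 [Pa0 a0_neq0]] P_inv; have [P_ideal P1 _] := P_prime.
have Pinv (s : {lrmorphism A -> A}) : is_alg_aut s -> forall a, P a -> P (s a).
  by move=> /P_inv sP a Pa; apply/sP; exists a.
have PE := nonzero_ideal_contains_prod A_Sn P_ideal Pa0 a0_neq0.
have [i Pei] := prime_contains_factor A_Sn P_prime (index_enum_uniq _) PE.
have Pe j : P (e j).
  have [s [s_aut sxy]] := Sn_perm_aut A_Sn (tperm i j).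
  have := Pinv s s_aut _ Pei; rewrite rmorphB rmorph1 rmorphM /=.
  by have [-> ->] := sxy i; rewrite tpermL.
have aP := a_ideal_min P_ideal Pe.
move=> a; split=> [Pa|]; last exact: aP.
have [m [p Ip]] := clear_denominators a; apply: (@clear_denominators0 m).
(* A nonzero [p] would put [ev p] in [P], because [X m * a] and the difference are in [P];
   invariance would then give 1. *)
suff p0 : p = 0 by move: Ip; rewrite p0 raddf0 subr0.
apply/eqP/negPn/negP => p0; apply: P1; apply: (@invariant_ideal_poly P p) => //.
rewrite -[ev p](subKr (X m * a)); apply: is_idealB => //; last exact: aP.
exact: is_idealMl.
Qed.

End CommutatorIdeal.

Theorem theorem9p8 (K : fieldType) (charK0 : [pchar K] =i pred0)
  (n : nat) (n_gt0 : (0 < n)%N)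
  (A : algType K) (x y : 'I_n -> A) (HA : is_Sn x y)
  (P : A -> Prop) :
  ([/\ is_prime_ideal P, (exists a, P a /\ a <> 0) &
       forall s : {lrmorphism A -> A}, is_alg_aut s -> image_eq s P])
  <-> (forall a, P a <-> a_ideal x y a).
Proof.
split=> [[P_prime P_neq0 P_inv]|PE].
  exact: (invariant_prime_eq HA charK0).
have -> : P = a_ideal x y by apply: funext => a; apply/propext.
split; first exact: (a_ideal_prime HA charK0).
  (* Positivity of [n] supplies an index; for $n = 0$ the sum $\mathfrak{a}_n$ is empty, hence
     zero. *)
  exists (1 - x (Ordinal n_gt0) * y (Ordinal n_gt0)).
  by split; [apply: a_ideal_mem | apply: (e_neq0 HA)].
exact: (a_ideal_aut HA).
Qed.
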